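(* Let $k\ge 4$ be an even integer, let $t=\lfloor (k-1)/2\rfloor$, and let $F$ be a 2-connected graph with $p(F)\ge t+1$. Let $\mathcal{F}=\mathcal{C}_{\ge k}\cup\{F\}$. Then for all sufficiently large $n$, $$\mathrm{ex}(n,\mathcal{F})=n\max\left\{\frac{k-2}{2},\frac{\mathrm{ex}(k-1,F)}{k-2}\right\}+O_k(1).$$
   Context: All graphs are finite and simple. A graph is $\mathcal{G}$-free, for a family $\mathcal{G}$ of graphs, if it contains no member of $\mathcal{G}$ as a (not necessarily induced) subgraph. $\mathrm{ex}(n,\mathcal{G})$ is the maximum number of edges in an $n$-vertex $\mathcal{G}$-free graph, and $\mathrm{ex}(n,F)=\mathrm{ex}(n,\{F\})$. $\mathcal{C}_{\ge k}$ is the set of all cycles of length at least $k$. If $F$ is bipartite, $p(F)$ is the smallest possible size of a color class among all proper 2-colorings of $F$; if $F$ is not bipartite, $p(F)=\infty$. $O_k(1)$ denotes a quantity whose absolute value is bounded by a constant depending only on $k$; ''sufficiently large $n$'' means $n\ge n_0$ for some $n_0$ depending only on $k$ and $F$. *)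

(* Defs.v *)
From mathcomp Require Import all_boot all_order all_algebra.
From mathcomp Require Import boolp constructive_ereal.

Set Implicit Arguments.
Unset Strict Implicit.
Unset Printing Implicit Defensive.

Import Order.TTheory GRing.Theory Num.Theory.

Record sgraph := SGraph {
  vertex :> finType;
  adj : rel vertex;
  adj_sym : symmetric adj;
  adj_irrefl : irreflexive adj }.

Definition contains (G H : sgraph) : Prop :=
  exists2 f : H -> G, injective f & forall x y, adj x y -> adj (f x) (f y).

(* A predicate rather than a set from classical_sets, whose universe is too
   small to contain sgraph. *)
Definition graph_family := sgraph -> Prop.

Definition is_free (FF : graph_family) (G : sgraph) : Prop :=
  forall H, FF H -> ~ contains G H.

Section EdgeSetGraph.
Variables (T : finType) (E : {set {set T}}).

Definition edge_rel : rel T := [rel x y | (x != y) && ([set x; y] \in E)].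

Lemma edge_rel_sym : symmetric edge_rel.
Proof. by move=> x y; rewrite /edge_rel /= eq_sym setUC. Qed.

Lemma edge_rel_irrefl : irreflexive edge_rel.
Proof. by move=> x; rewrite /edge_rel /= eqxx. Qed.

Definition edge_graph := SGraph edge_rel_sym edge_rel_irrefl.
End EdgeSetGraph.

(* Graphs with vertex set 'I_n are enumerated by their edge sets, i.e. by the
   sets of two-element subsets of 'I_n. *)
Definition ex_number (n : nat) (FF : graph_family) : nat :=
  \max_(E : {set {set 'I_n}} | [forall e in E, #|e| == 2]
                               && `[< is_free FF (edge_graph E) >]) #|E|.

Definition ex_number1 (n : nat) (F : sgraph) : nat := ex_number n (fun H => H = F).

Section CycleGraph.
Variable m : nat.

(* The condition i != j only matters for m = 1, where ordS has a fixed point. *)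
Definition cycle_rel : rel 'I_m :=
  [rel i j | (i != j) && ((j == ordS i) || (i == ordS j))].

Lemma cycle_rel_sym : symmetric cycle_rel.
Proof. by move=> i j; rewrite /cycle_rel /= eq_sym orbC. Qed.

Lemma cycle_rel_irrefl : irreflexive cycle_rel.
Proof. by move=> i; rewrite /cycle_rel /= eqxx. Qed.

Definition cycle_graph := SGraph cycle_rel_sym cycle_rel_irrefl.
End CycleGraph.

Definition cycles_ge (k : nat) : graph_family :=
  fun G => exists m : nat, [/\ 3 <= m, k <= m & G = cycle_graph m].

Definition connected_in (G : sgraph) (S : {set G}) : bool :=
  [forall x in S, forall y in S,
     connect [rel u v | [&& u \in S, v \in S & adj u v]] x y].

Definition two_connected (G : sgraph) : bool :=
  [&& 2 < #|G|, connected_in [set: G]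
    & [forall v : G, connected_in (~: [set v])]].

Definition proper_2coloring (G : sgraph) (c : {ffun G -> bool}) : bool :=
  [forall x, forall y, adj x y ==> (c x != c y)].

(* The minimum over an empty range is +oo, which is the value of
   min_color_class on non-bipartite graphs. *)
Definition min_color_class (G : sgraph) : \bar rat :=
  \big[Order.min/+oo%E]_(cb : {ffun G -> bool} * bool | proper_2coloring cb.1)
     (#|[set x | cb.1 x == cb.2]|%:R)%:E.

(* Main.v *)
Require Import Defs.
From mathcomp Require Import all_boot all_order all_algebra.
From mathcomp Require Import boolp constructive_ereal.
From mathcomp Require Import zify ring lra.

Set Implicit Arguments.
Unset Strict Implicit.
Unset Printing Implicit Defensive.

Import Order.TTheory GRing.Theory Num.Theory.

(* Write k = 2t + 2.  Upper bound: let M be the maximum in the statement.  In a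
   smallest graph with more than M(n - 1) edges, deleting a vertex of degree at
   most t or splitting at a cut vertex would give a smaller one, and at most k - 1
   vertices are ruled out by the definition of M; so Dirac's theorem yields a cycle
   of length at least 2(t + 1) = k.  Lower bound: the complete bipartite graph
   K_{t,n-t}, and copies of an extremal F-free graph on k - 1 vertices sharing one
   vertex; the latter is free of F and of long cycles because these have no cut
   vertex.  Edges are counted twice, as ordered pairs of adjacent vertices. *)

(** * Consecutive entries and ends of sequences *)

(** In the second case each of the [size s] consecutive pairs satisfies at most one of [f] on its
    left entry and [g] on its right entry; summing over the pairs gives the bound. This is the
    counting step of Ore's argument. *)
Lemma count_consecutive (T : Type) (f g : pred T) (x : T) (s : seq T) :
  (exists s1 p q s2, [/\ x :: s = s1 ++ p :: q :: s2, f p & g q]) \/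
  count f (belast x s) + count g s <= size s.
Proof.
elim: s x => [|y s IHs] x; first by right.
have [[s1 [p [q [s2 [-> fp gq]]]]]|IH] := IHs y.
  by left; exists (x :: s1), p, q, s2.
case fx: (f x); last by right; move: IH => /=; rewrite fx; case: (g y) => /=; lia.
case gy: (g y); last by right; move: IH => /=; rewrite fx gy; lia.
by left; exists [::], x, y, s.
Qed.

Lemma split_last_has (T : Type) (P : pred T) (s : seq T) :
  has P s -> exists s1 x s2, [/\ s = s1 ++ x :: s2, P x & ~~ has P s2].
Proof.
elim: s => //= y s IHs; case: (boolP (has P s)) => [/IHs|hs].
  by case=> s1 [x [s2 [-> Px hs2]]] _; exists (y :: s1), x, s2.
by rewrite orbF => Py; exists [::], y, s.
Qed.

Lemma last_rev (T : Type) (x : T) (s : seq T) : last x (rev s) = head x s.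
Proof. by case: s => //= y s; rewrite rev_cons last_rcons. Qed.

Lemma head_rev (T : Type) (x : T) (s : seq T) : head x (rev s) = last x s.
Proof. by rewrite -last_rev revK. Qed.

(** * Dirac's bound on the circumference *)

Section CircumferenceBound.
Variable G : sgraph.

Definition degree (x : G) := \sum_(y : G) (adj x y : nat).

Lemma count_degree (x : G) (s : seq G) :
  uniq s -> (forall y, adj x y -> y \in s) -> count (adj x) s = degree x.
Proof.
move=> us hs; rewrite /degree -size_filter -big_mkcond /= sum1_card.
rewrite -(card_uniqP (filter_uniq _ us)); apply: eq_card => y.
rewrite mem_filter; apply: andb_idr => /hs //.
Qed.

Lemma sorted_rev_adj (s : seq G) : sorted (@adj G) (rev s) = sorted (@adj G) s.
Proof. by rewrite rev_sorted; apply: eq_sorted => x y; rewrite adj_sym. Qed.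

Lemma sorted_join (x0 : G) (s1 s2 : seq G) :
  sorted (@adj G) s1 -> sorted (@adj G) s2 ->
  adj (last x0 s1) (head x0 s2) -> sorted (@adj G) (s1 ++ s2).
Proof.
case: s1 => [|x s1] // ss1; case: s2 => [|y s2]; first by rewrite cats0.
by rewrite /= cat_path /= in ss1 * => -> ->; rewrite ss1.
Qed.

(** A cycle, or a single edge, spanned by [A], with a possibly empty tail [B] leaving the last
    vertex of [A]. *)
Definition closing (A B : seq G) : Prop :=
  exists x s, [/\ A = x :: s, adj x (last x s), uniq (A ++ B) & sorted (@adj G) (A ++ B)].

(** The first edge of any path with at least two vertices may serve as [A], so a longest closing
    pair is a longest path. Among these, one with [A] as long as possible is chosen. *)
Lemma exists_maximal_closing :
  (exists x y : G, adj x y) ->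
  exists A B, [/\ closing A B,
    (forall s : seq G, uniq s -> sorted (@adj G) s -> size s <= size (A ++ B)) &
    (forall A' B', closing A' B' -> size (A' ++ B') = size (A ++ B) ->
       size A' <= size A)].
Proof.
move=> [x0 [y0 axy0]].
have sz (s : seq G) : uniq s -> size s <= #|G|.
  by move=> us; rewrite -(card_uniqP us) max_card.
pose Q m := `[< exists A B, closing A B /\ size (A ++ B) = m >].
have Qub m : Q m -> m <= #|G|.
  by move/asboolP=> [A [B [[x [s [_ _ us _]]] <-]]]; apply: sz.
have Q2 : Q 2.
  apply/asboolP; exists [:: x0; y0], [::]; split=> //.
  exists x0, [:: y0]; split; rewrite //= ?inE ?axy0 ?andbT //.
  by apply: contraL axy0 => /eqP ->; rewrite adj_irrefl.
have exQ : exists m, Q m by exists 2.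
case: (ex_maxnP exQ Qub) => m Qm mmax.
pose Q' a := `[< exists A B, [/\ closing A B, size (A ++ B) = m & size A = a] >].
have Q'ub a : Q' a -> a <= m.
  by move/asboolP=> [A [B [_ <- <-]]]; rewrite size_cat leq_addr.
have exQ' : exists a, Q' a.
  move/asboolP: Qm => [A [B [c sAB]]].
  by exists (size A); apply/asboolP; exists A, B.
case: (ex_maxnP exQ' Q'ub) => a /asboolP[A [B [cAB sAB sA]]] amax.
exists A, B; split=> //; last first.
  move=> A' B' c e; rewrite sA; apply: amax; apply/asboolP.
  by exists A', B'; split=> //; rewrite e.
case=> [|x [|y s]] // us ss; rewrite sAB; first exact: leq_trans (mmax _ Q2).
apply: mmax; apply/asboolP; exists [:: x; y], s; split=> //.
by exists x, [:: y]; split=> //=; case/andP: ss.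
Qed.

(** Replacing [A] by [x :: s] gives another longest path. A neighbour of [x] off the path would
    extend it, and one in [B] would give a closing pair of the same total length with a longer first
    part. *)
Lemma closing_end_neighbours (A B : seq G) (x : G) (s : seq G) :
  closing A B ->
  (forall s' : seq G, uniq s' -> sorted (@adj G) s' -> size s' <= size (A ++ B)) ->
  (forall A' B', closing A' B' -> size (A' ++ B') = size (A ++ B) ->
     size A' <= size A) ->
  perm_eq (x :: s) A -> sorted (@adj G) (x :: s) -> last x s = last x A ->
  forall y, adj x y -> y \in A.
Proof.
move=> [z [w [eA _ uAB sAB]]] longest maximal pA sx lx y axy.
have uxB : uniq ((x :: s) ++ B) by rewrite (perm_uniq (perm_cat pA (perm_refl B))).
have sxB : sorted (@adj G) ((x :: s) ++ B).
  case: B uAB sAB uxB {longest maximal} => [|b B] uAB sAB uxB; first by rewrite cats0.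
  rewrite /= in sx; move: sAB; rewrite eA /= !cat_path /=.
  by rewrite lx eA /= => /and3P[_ -> ->]; rewrite sx.
have szA : size (x :: s) = size A by apply: perm_size.
have yAB : y \in (x :: s) ++ B.
  apply/negPn/negP => yN.
  have uy : uniq (y :: (x :: s) ++ B) by rewrite cons_uniq yN.
  have := longest _ uy; rewrite [sorted _ _]/= adj_sym axy => /(_ sxB).
  by rewrite /= !size_cat -szA /=; lia.
move: yAB; rewrite mem_cat (perm_mem pA) => /orP[//|yB].
case/splitPr: yB longest maximal uAB sAB uxB sxB => B1 B2 longest maximal _ _ uxB sxB.
have eB : (x :: s) ++ B1 ++ y :: B2 = (x :: s ++ rcons B1 y) ++ B2.
  by rewrite /= -cats1 -!catA.
have cl : closing (x :: s ++ rcons B1 y) B2.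
  exists x, (s ++ rcons B1 y); split; rewrite -?eB //.
  by rewrite last_cat last_rcons.
have := maximal _ _ cl; rewrite -eB !(size_cat _ (B1 ++ _)) szA => /(_ erefl).
by rewrite -szA /= size_cat size_rcons; lia.
Qed.

(* Dirac's circumference theorem.  Take a longest path [A ++ B] whose first
   vertex [v] is adjacent to the last vertex [z] of [A], with [A] as long as
   possible.  If [A] does not close into a long enough cycle, let [x] be the last
   vertex of [A] other than [z] with a neighbour outside [A], and [y] its
   successor.  Unless [y = z], all neighbours of [v] and of [y] are in [A], which
   has fewer than [2 * d] vertices, so Ore's counting argument reroutes [A] into
   a path from [x] to [z], contradicting one of the two maximalities. *)
Lemma circumference_ge (d : nat) :
  (forall (v : G) (X : {set G}),
    v \notin X -> X != set0 -> (exists2 y, y \notin X & y != v) ->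
    exists x y, [/\ x \in X, y \notin X, y != v & adj x y]) ->
  0 < d -> 2 * d <= #|G| -> (forall x : G, d <= degree x) ->
  exists p : seq G, [/\ uniq p, cycle (@adj G) p & 2 * d <= size p].
Proof.
move=> nocut d0 dG degd.
have exadj : exists x y : G, adj x y.
  have /card_gt0P[x _] : 0 < #|G| by lia.
  have [y|noadj] := pickP (@adj G x); first by exists x, y.
  by have := degd x; rewrite /degree big1 => [|y _]; [lia | rewrite noadj].
have [A [B [cAB longest maximal]]] := exists_maximal_closing exadj.
have endP := closing_end_neighbours cAB longest maximal.
have [v [s [eA avl uAB sAB]]] := cAB.
have uA : uniq A by move: uAB; rewrite cat_uniq => /and3P[].
have sA : sorted (@adj G) A by case: (cat_sorted2 sAB).
have [|ltA] := leqP (2 * d) (size A).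
  move=> dA; exists A; split=> //; move: sA; rewrite eA /= rcons_path => ->.
  by rewrite adj_sym.
set z := last v s in avl.
have zA w : last w A = z by rewrite eA.
have nv y : adj v y -> y \in A by apply: (endP v s) => //; rewrite -?eA ?zA.
have vA : v \in A by rewrite eA mem_head.
have vz : v != z by apply: contraL avl => /eqP {1}->; rewrite adj_irrefl.
pose P x := (x != z) && [exists y, (y \notin A) && adj x y].
have hasP : has P A.
  (* Since [z] is not a cut vertex and [A] does not cover the graph, some vertex of [A] other than
     [z] has a neighbour outside [A]. *)
  have [||| x [y [xX yX yz axy]]] := nocut z [set x in A | x != z].
  - by rewrite inE eqxx andbF.
  - by apply/set0Pn; exists v; rewrite inE vA.
  - have [y yA|allA] := pickP [predC A].
      exists y; rewrite ?inE ?(negbTE yA) //.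
      by apply: contraNneq yA => ->; rewrite eA mem_last.
    have := max_card (mem A); have := card_uniqP uA.
    have -> : #|A| = #|G| by apply: eq_card => y; have := allA y; rewrite /= => /negbFE ->.
    by lia.
  move: xX yX; rewrite !inE yz andbT => /andP[xA xz] yA.
  by apply/hasP; exists x => //; rewrite /P xz; apply/existsP; exists y; rewrite yA.
have [L [x [R [eLR /andP[xz /existsP[o /andP[oA axo]]] hR]]]] := split_last_has hasP.
(* Such a rerouting suffices: [endP] would put all neighbours of [x] in [A], but [o] is outside. *)
suff [[//|x' u] [pu su hu lu]] : exists u, [/\ perm_eq u A, sorted (@adj G) u,
    head v u = x & last v u = z].
- by move/perm_size: pu; rewrite eA.
- move: hu lu => /= -> lu in pu su *.
  by have := endP _ _ pu su; rewrite lu zA => /(_ erefl _ axo); rewrite (negbTE oA).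
have eL : last x (rev L) = v.
  case: L eLR {hasP} => [|v' L] eLR.
    by move: oA; rewrite nv //; move: eLR axo; rewrite eA => -[<-].
  by rewrite rev_cons last_rcons; move: eLR; rewrite eA => -[].
case: R eLR hR => [|y R] eLR hR.
  by move: xz; rewrite -(zA v) eLR last_cat /= eqxx.
have eA' : A = rcons L x ++ y :: R by rewrite cat_rcons.
have lR : last y R = z by rewrite -(zA v) eLR last_cat.
have [s1 s2] : sorted (@adj G) (x :: rev L) /\ sorted (@adj G) (y :: R).
  rewrite -rev_rcons sorted_rev_adj; move: sA; rewrite eA'.
  by case/cat_sorted2.
have pLR : perm_eq ((x :: rev L) ++ y :: R) A.
  by rewrite eA' -rev_rcons perm_cat2r perm_rev.
(* If [y = z], go back from [x] to [v] and use the edge from [v] to [z]. *)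
have [yz|yz] := eqVneq y z.
  exists ((x :: rev L) ++ y :: R); split=> //; last by rewrite last_cat.
  by apply: (@sorted_join v) => //; rewrite /= eL yz.
have ny w : adj y w -> w \in A.
  move=> ayw; apply/negPn/negP => wA; case/negP: hR => /=.
  by rewrite /P yz /=; apply/orP; left; apply/existsP; exists w; rewrite wA.
(* Rerouting: from [x] back to [p], across to [v], forward to [q], across to [y], on to [z]. *)
have [[t1 [p [q [t2 [et vp yq]]]]]|c1] := count_consecutive (adj v) (adj y) x (rev L).
  exists ((rcons t1 p ++ rev (q :: t2)) ++ y :: R); split.
  - apply: perm_trans pLR; rewrite perm_cat2r et -cat_rcons perm_cat2l.
    by rewrite perm_rev.
  - move: s1; rewrite et -cat_rcons => /cat_sorted2[s11 s12].
    apply: (@sorted_join v) => //; last by rewrite rev_cons last_cat last_rcons adj_sym.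
    apply: (@sorted_join v) => //; first by rewrite sorted_rev_adj.
    rewrite last_rcons head_rev.
    have -> : last v (q :: t2) = last v (x :: rev L) by rewrite et last_cat.
    by rewrite /= eL adj_sym.
  - by case: (t1) et => [|? ?] [].
  - by rewrite last_cat.
(* Rerouting: from [x] back to [v], across to [p], back to [y], across to [q], on to [z]. *)
have [[t1 [p [q [t2 [et vp yq]]]]]|c2] := count_consecutive (adj v) (adj y) y R.
  exists (((x :: rev L) ++ rev (rcons t1 p)) ++ q :: t2); split=> //.
  - apply: perm_trans pLR; rewrite et -catA perm_cat2l -cat_rcons perm_cat2r.
    by rewrite perm_rev.
  - move: s2; rewrite et -cat_rcons => /cat_sorted2[s21 s22].
    apply: (@sorted_join v) => //.
      apply: (@sorted_join v) => //; first by rewrite sorted_rev_adj.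
      by rewrite /= eL rev_rcons.
    rewrite last_cat last_rev.
    by case: (t1) et => [|? ?] [<-].
  - by rewrite last_cat -lR; have := congr1 (last v) et; rewrite last_cat.
have countA f : count f A = count f (x :: rev L) + count f (y :: R).
  by rewrite -count_cat; apply/esym/permP.
have dv : degree v = count (adj v) (belast x (rev L)) + count (adj v) (y :: R).
  rewrite -(count_degree uA nv) countA [x :: rev L]lastI -cats1 count_cat /=.
  by rewrite eL adj_irrefl addn0 [LHS]/= addn0.
have dy : degree y = count (adj y) (x :: rev L) + count (adj y) R.
  by rewrite -(count_degree uA ny) countA /= adj_irrefl.
have szA := perm_size pLR; rewrite size_cat /= in szA.
have := degd v; have := degd y; rewrite dv dy.
have -> : count (adj v) (y :: R) = count (adj v) (belast y R) + adj v (last y R).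
  by rewrite lastI -cats1 count_cat /= addn0.
(* With both reroutings excluded, the degrees of [v] and [y] add up to at most [size A]: the two
   counts leave out only the adjacencies of [y] to [x] and of [v] to [z]. *)
have arith (a b c e l r p q w : nat) : w < 2 * d -> l.+1 + r.+1 = w ->
    a + b <= l -> c + e <= r -> p <= 1 -> q <= 1 ->
    d <= p + b + e -> d <= a + (c + q) -> False by clear; lia.
by move=> dy' dv'; case: (arith _ _ _ _ _ _ _ _ _ ltA szA c1 c2 (leq_b1 _) (leq_b1 _) dy' dv').
Qed.

End CircumferenceBound.

(** * Darts and extremal numbers *)

Definition dart_count (G : sgraph) := \sum_(x : G) degree x.

Lemma dart_edge_graph (T : finType) (E : {set {set T}}) :
  [forall e in E, #|e| == 2] -> dart_count (edge_graph E) = 2 * #|E|.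
Proof.
move=> /forall_inP E2; rewrite mulnC -sum_nat_const /dart_count /degree.
rewrite pair_bigA /= -big_mkcond /=.
rewrite (partition_big (fun p => [set p.1; p.2]) (mem E)) /= => [|p /andP[]//].
apply: eq_bigr => e eE; have /cards2P[a [b [ab eab]]] := E2 e eE.
transitivity #|[set (a, b); (b, a)]|.
  rewrite sum1_card; apply: eq_card => -[x y]; rewrite !inE unfold_in /= !xpair_eqE.
  apply/andP/orP => [[/andP[xy _] /eqP exy]|].
    have : x \in e by rewrite -exy !inE eqxx.
    have : y \in e by rewrite -exy !inE eqxx orbT.
    rewrite eab !inE => /orP[]/eqP ey /orP[]/eqP ex; move: xy; rewrite ey ex !eqxx //.
      by right.
    by left.
  by case=> /andP[/eqP-> /eqP->]; rewrite /edge_rel /= ?(eq_sym b a) ?(setUC [set b]) -eab ab eE.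
by rewrite cards2 xpair_eqE negb_and ab.
Qed.

Lemma contains_trans (G H K : sgraph) : contains G H -> contains H K -> contains G K.
Proof.
move=> [f fI fA] [g gI gA]; exists (f \o g); first exact: inj_comp.
by move=> x y /gA/fA.
Qed.

Lemma is_free_contained (FF : graph_family) (G H : sgraph) :
  contains G H -> is_free FF G -> is_free FF H.
Proof. by move=> GH fG K FK HK; apply: (fG K FK); apply: contains_trans HK. Qed.

(** Numbering the vertices turns [G] into a competitor on ['I_#|G|], so constructions may use any
    vertex type. *)
Lemma ex_number_ge (FF : graph_family) (G : sgraph) :
  is_free FF G -> dart_count G <= 2 * ex_number #|G| FF.
Proof.
move=> fG.
pose E := [set e : {set 'I_#|G|} | [exists i, exists j,
  adj (enum_val i : G) (enum_val j) && (e == [set i; j])]].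
have adjE i j : adj (i : edge_graph E) j = adj (enum_val i : G) (enum_val j).
  apply/andP/idP => [[ij]|aij].
    rewrite inE => /existsP[i' /existsP[j' /andP[aij /eqP eij]]].
    have : i \in [set i'; j'] by rewrite -eij !inE eqxx.
    have : j \in [set i'; j'] by rewrite -eij !inE eqxx orbT.
    rewrite !inE => /orP[]/eqP ey /orP[]/eqP ex; move: ij; rewrite ey ex ?eqxx //.
    by rewrite adj_sym.
  split; first by apply: contraL aij => /eqP->; rewrite adj_irrefl.
  by rewrite inE; apply/existsP; exists i; apply/existsP; exists j; rewrite aij eqxx.
have E2 : [forall e in E, #|e| == 2].
  apply/forall_inP => e; rewrite inE => /existsP[i /existsP[j /andP[aij /eqP->]]].
  by rewrite cards2 (_ : i != j) //; apply: contraL aij => /eqP->; rewrite adj_irrefl.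
have fE : is_free FF (edge_graph E).
  apply: is_free_contained fG; exists (enum_val : edge_graph E -> G).
    exact: enum_val_inj.
  by move=> i j; rewrite adjE.
have -> : dart_count G = dart_count (edge_graph E).
  rewrite /dart_count /degree (reindex (enum_val : 'I_#|G| -> G)) /=; last first.
    by apply: onW_bij; apply: enum_val_bij.
  apply: eq_bigr => i _; rewrite (reindex (enum_val : 'I_#|G| -> G)) /=; last first.
    by apply: onW_bij; apply: enum_val_bij.
  by apply: eq_bigr => j _; rewrite -adjE.
rewrite dart_edge_graph // leq_mul2l /=.
by apply: (leq_bigmax_cond E); rewrite E2; apply/asboolP.
Qed.

(** * Graphs without cut vertices *)

(** Empty [B] expresses connectedness and a singleton [B] the absence of a cut vertex, both in terms
    of an edge leaving [X]. *)
Definition nonseparable (H : sgraph) : Prop :=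
  forall B X : {set H}, #|B| <= 1 -> X != set0 -> [disjoint X & B] ->
  (exists2 y, y \notin X & y \notin B) ->
  exists x y, [/\ x \in X, y \notin X, y \notin B & adj x y].

Lemma two_connected_nonseparable (H : sgraph) : two_connected H -> nonseparable H.
Proof.
move=> /and3P[_ c0 c1] B X B1 /set0Pn[x xX] dXB [y yX yB].
have /forall_inP cB : connected_in (~: B).
  case: (posnP #|B|) => [/cards0_eq->|B0]; first by rewrite setC0.
  have /cards1P[v ->] : #|B| == 1 by rewrite eqn_leq B1.
  by move/forallP: c1.
have xB : x \notin B by rewrite (disjointFr dXB xX).
have := cB x; rewrite inE => /(_ xB)/forall_inP/(_ y); rewrite inE => /(_ yB).
case/connectP=> p; elim: p x xX xB => [|z p IHp] x xX xB /=.
  by move=> _ yx; rewrite yx xX in yX.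
case/andP=> /and3P[_]; rewrite inE => zB axz pp ey.
have [zX|zX] := boolP (z \in X); first exact: IHp zX zB pp ey.
by exists x, z.
Qed.

Lemma cycle_graph_adj_ordS (m : nat) (i : cycle_graph m) :
  1 < m -> adj i (ordS i : cycle_graph m).
Proof.
move=> m1; apply/andP; split; last by rewrite eqxx.
apply/eqP => /(congr1 val) /=; have := ltn_ord i.
rewrite leq_eqVlt => /orP[/eqP e|im]; last by rewrite modn_small //; lia.
by rewrite e modnn; lia.
Qed.

(** Deleting a vertex [v] from a cycle leaves a path starting at its successor, and membership in
    [X] is constant along this path if no edge leaves [X]. *)
Lemma cycle_graph_nonseparable (m : nat) : nonseparable (cycle_graph m).
Proof.
case: m => [|m] B X B1 /set0Pn[x xX] dXB [y yX yB]; first by case: x xX.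
apply: contrapT => noedge.
have xB : x \notin B by rewrite (disjointFr dXB xX).
have xy : x != y by apply: contraNneq yX => <-.
have m0 : 0 < m.
  by case: m x y xy {X B B1 xX dXB yX yB noedge xB} => // x y; rewrite !ord1.
have adjS (i : cycle_graph m.+1) : adj i (ordS i : cycle_graph m.+1).
  by apply: cycle_graph_adj_ordS.
have step (i : cycle_graph m.+1) : i \notin B -> ordS i \notin B -> (ordS i \in X) = (i \in X).
  move=> iB sB; apply/idP/idP => [sX|iX]; apply: contrapT => /negP nX; apply: noedge.
    by exists (ordS i), i; rewrite adj_sym adjS.
  by exists i, (ordS i); rewrite adjS.
have iterE (w : 'I_m.+1) j : iter j (@ordS m.+1) w = (w + j) %% m.+1 :> nat.
  elim: j => [|j IHj]; first by rewrite addn0 modn_small.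
  by rewrite iterS /= IHj -addn1 modnDml addn1 addnS.
have [v Bv] : exists v : cycle_graph m.+1, B \subset [set v].
  have [->|[v vB]] := set_0Vmem B; first by exists x; rewrite sub0set.
  exists v; apply/subsetP => u uB; rewrite inE; apply/eqP.
  by move/card_le1_eqP: B1; apply.
have reach (u : cycle_graph m.+1) : u \notin B -> (u \in X) = (ordS v \in X).
  move=> uB.
  have vm : v <= m by rewrite -ltnS ltn_ord.
  have um : u <= m by rewrite -ltnS ltn_ord.
  have ordSv i : iter i (@ordS m.+1) (ordS v) = (v + i.+1) %% m.+1 :> nat.
    by rewrite -iterSr iterE.
  (* The number of steps from the successor of [v] to [u], that is [u - v - 1] modulo [m + 1]. The
     walk meets [v] only after [m] steps, hence only if [u] is [v] itself. *)
  pose j := (u + (m - v)) %% m.+1.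
  have ju : iter j (@ordS m.+1) (ordS v) = u.
    apply: val_inj; rewrite /= ordSv /j -addSnnS modnDmr.
    by rewrite (_ : v.+1 + (u + (m - v)) = u + m.+1) ?modnDr ?modn_small //; lia.
  have jm : j <= m by rewrite -ltnS ltn_pmod.
  have jB i : i <= j -> iter i (@ordS m.+1) (ordS v) \notin B.
    move=> ij; apply/negP => iB; move/subsetP: Bv => /(_ _ iB); rewrite inE => /eqP ei.
    have im : i = m.
      have := congr1 val ei; rewrite /= ordSv => e.
      have : v + i.+1 == v + 0 %[mod m.+1] by rewrite e addn0 modn_small.
      by rewrite eqn_modDl mod0n => d; have := @dvdn_leq m.+1 i.+1 isT d; lia.
    have ijE : i = j by lia.
    by move: uB; rewrite -ju -ijE iB.
  rewrite -{1}ju; elim: {uB ju} j {jm} jB => // j IHj jB.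
  rewrite iterS (step (iter j _ _)); first by apply: IHj => i ij; apply: jB; lia.
    by apply: jB; lia.
  by rewrite -iterS; apply: jB.
by move: yX; rewrite reach // -(reach x) // xX.
Qed.

Definition block_family (FF : graph_family) : Prop :=
  forall H, FF H -> 1 < #|H| /\ nonseparable H.

Lemma edge_exists (H : sgraph) : 1 < #|H| -> nonseparable H -> exists x y : H, adj x y.
Proof.
move=> /card_gt1P[x [y [_ _ xy]]] /(_ set0 [set x]).
rewrite cards0 => /(_ isT) []; first by apply/set0Pn; exists x; rewrite inE.
- by rewrite -setI_eq0 setI0.
- by exists y; rewrite !inE // eq_sym.
by move=> u [v [_ _ _ auv]]; exists u, v.
Qed.

(** Every forbidden graph has an edge, so the edgeless graph is free and the maximum ranges over a
    nonempty set. *)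
Lemma ex_number_attained (FF : graph_family) (n : nat) : block_family FF ->
  exists G : sgraph, [/\ #|G| = n, is_free FF G & dart_count G = 2 * ex_number n FF].
Proof.
move=> bF.
pose Q (E : {set {set 'I_n}}) := [forall e in E, #|e| == 2]
                               && `[< is_free FF (edge_graph E) >].
have Q0 : Q set0.
  apply/andP; split; first by apply/forall_inP => e; rewrite inE.
  apply/asboolP => H FH [f _ fA]; have [x [y /fA]] := uncurry (@edge_exists H) (bF H FH).
  by case/andP=> _; rewrite inE.
have [|E QE eE] := @eq_bigmax_cond _ Q (fun E => #|E|); first by apply/card_gt0P; exists set0.
exists (edge_graph E); move/andP: QE => [E2 /asboolP fE].
split=> //; first exact: card_ord.
by rewrite dart_edge_graph //; congr (2 * _); apply: esym eE.
Qed.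

(** * Gluing graphs at a vertex *)

Section Glue.
Variables (G1 G2 : sgraph) (z1 : G1) (z2 : G2).

(** The vertex [z2] is dropped from [G2] and [z1] inherits its neighbours, which identifies the
    two. *)
Definition glue_rel : rel (G1 + {y : G2 | y \in predC1 z2}) := fun u v =>
  match u, v with
  | inl x, inl y => adj x y
  | inr x, inr y => adj (val x) (val y)
  | inl x, inr y => (x == z1) && adj z2 (val y)
  | inr x, inl y => (y == z1) && adj z2 (val x)
  end.

Lemma glue_rel_sym : symmetric glue_rel.
Proof. by move=> [x|x] [y|y] //=; rewrite adj_sym. Qed.

Lemma glue_rel_irrefl : irreflexive glue_rel.
Proof. by move=> [x|x] /=; rewrite adj_irrefl. Qed.

Definition glue := SGraph glue_rel_sym glue_rel_irrefl.

Lemma card_glue : #|glue| = #|G1| + #|G2|.-1.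
Proof. by rewrite card_sum card_sig (cardC1 z2). Qed.

Lemma dart_glue : dart_count glue = dart_count G1 + dart_count G2.
Proof.
have aux (F : G2 -> nat) :
    \sum_(y : {y : G2 | y \in predC1 z2}) F (val y) = \sum_(y | y != z2) F y.
  by rewrite -(big_sub (predC1 z2) F).
rewrite /dart_count /degree big_sumType /=.
have -> : \sum_(x : G1) \sum_(v : glue) (glue_rel (inl x) v : nat)
    = \sum_(x : G1) \sum_(y : G1) (adj x y : nat) + \sum_(y : G2) (adj z2 y : nat).
  under eq_bigr do rewrite big_sumType /=.
  rewrite big_split /=; congr (_ + _).
  rewrite (bigD1 z1) //= eqxx /= [X in _ + X]big1 ?addn0; last first.
    by move=> x /negbTE->; rewrite big1.
  rewrite (aux (fun y => adj z2 y : nat)) [in RHS](bigD1 z2) //=.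
  by rewrite adj_irrefl.
have -> : \sum_(y : {y : G2 | y \in predC1 z2}) \sum_(v : glue) (glue_rel (inr y) v : nat)
    = \sum_(y : G2 | y != z2) \sum_(x : G2) (adj y x : nat).
  rewrite -(aux (fun y => \sum_(x : G2) (adj y x : nat))); apply: eq_bigr => y _.
  rewrite big_sumType /= (aux (fun x => adj (val y) x : nat)) [in RHS](bigD1 z2) //=.
  congr (_ + _); rewrite (bigD1 z1) //= eqxx adj_sym big1 ?addn0 //.
  by move=> x /negbTE->.
by rewrite -addnA -(bigD1 z2 (P := predT) (F := fun y => \sum_x (adj y x : nat))).
Qed.

(** The shared vertex separates the two sides, so a copy of [H] with a vertex on the side of [G2]
    cannot have one in [G1] other than [z1]. *)
Lemma glue_contains (H : sgraph) : nonseparable H ->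
  contains glue H -> contains G1 H \/ contains G2 H.
Proof.
move=> nH [f fI fA].
have [[h0 [y0 fh0]]|noR] := pselect (exists h y, f h = inr y); last first.
  left; exists (fun h => if f h is inl x then x else z1).
    move=> h h'; case e: (f h) => [x|y]; last by case: noR; exists h, y.
    case e': (f h') => [x'|y']; last by case: noR; exists h', y'.
    by move=> xx; apply: fI; rewrite e e' xx.
  move=> h h' /fA; case e: (f h) => [x|y]; last by case: noR; exists h, y.
  by case e': (f h') => [x'|y'] //; case: noR; exists h', y'.
right.
(* [B] holds the preimage of the shared vertex, if any, and [X] the vertices sent properly into
   [G2]. *)
pose B := [set h | f h == inl z1].
pose X := [set h | if f h is inr _ then true else false].
have X0 : X != set0 by apply/set0Pn; exists h0; rewrite inE fh0.
have B1 : #|B| <= 1.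
  apply/card_le1_eqP => h h'; rewrite !inE => /eqP e /eqP e'.
  by apply: fI; rewrite e e'.
have dXB : [disjoint X & B].
  rewrite -setI_eq0; apply/eqP/setP => h; rewrite !inE.
  by case: (f h) => //= ?; rewrite andbF.
have noL h x : f h = inl x -> x = z1.
  move=> fh; apply/eqP/negPn/negP => xz.
  have [| h1 [h2 [h1X h2X h2B /fA]]] := nH B X B1 X0 dXB.
    by exists h; rewrite !inE fh //; apply: contra xz => /eqP[->].
  move: h1X h2X h2B; rewrite !inE.
  case: (f h1) => // u _; case: (f h2) => //= w _.
  by rewrite (inj_eq (@inl_inj _ _)) => /negbTE->.
exists (fun h => if f h is inr y then val y else z2).
  move=> h h'; case e: (f h) => [x|y]; case e': (f h') => [x'|y'].
  - by move=> _; apply: fI; rewrite e e' (noL _ _ e) (noL _ _ e').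
  - by move=> ey; have := valP y'; rewrite -ey !inE eqxx.
  - by move=> ey; have := valP y; rewrite ey !inE eqxx.
  - by move=> /val_inj yy; apply: fI; rewrite e e' yy.
move=> h h' /fA; case e: (f h) => [x|y]; case e': (f h') => [x'|y'] //=.
- by rewrite (noL _ _ e) (noL _ _ e') adj_irrefl.
- by case/andP.
- by rewrite adj_sym => /andP[].
Qed.
End Glue.

Lemma ex_number_glue (FF : graph_family) (n1 n2 : nat) : block_family FF ->
  ex_number n1.+1 FF + ex_number n2.+1 FF <= ex_number (n1 + n2).+1 FF.
Proof.
move=> bF; have [G1 [c1 f1 d1]] := ex_number_attained n1.+1 bF.
have [G2 [c2 f2 d2]] := ex_number_attained n2.+1 bF.
have /card_gt0P[z1 _] : 0 < #|G1| by rewrite c1.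
have /card_gt0P[z2 _] : 0 < #|G2| by rewrite c2.
have := @ex_number_ge FF (glue z1 z2); rewrite card_glue dart_glue c1 c2 d1 d2 -mulnDr leq_mul2l.
apply=> H FH; have [_ nH] := bF H FH.
by case/(glue_contains nH); [apply: f1|apply: f2].
Qed.

Lemma ex_number_copies (FF : graph_family) (m q r : nat) : block_family FF ->
  q * ex_number m.+1 FF <= ex_number (q * m + r).+1 FF.
Proof.
move=> bF; elim: q => [|q IHq] //; rewrite !mulSn -addnA.
by apply: leq_trans (ex_number_glue _ _ bF); rewrite leq_add2l.
Qed.

(** * Complete bipartite graphs *)

Section CompleteBipartite.
Variables a b : nat.

Definition biclique_rel : rel ('I_a + 'I_b) := fun u v =>
  match u, v with inl _, inr _ | inr _, inl _ => true | _, _ => false end.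

Lemma biclique_rel_sym : symmetric biclique_rel.
Proof. by case=> [?|?] []. Qed.

Lemma biclique_rel_irrefl : irreflexive biclique_rel.
Proof. by case. Qed.

Definition biclique := SGraph biclique_rel_sym biclique_rel_irrefl.

Lemma card_biclique : #|biclique| = a + b.
Proof. by rewrite card_sum !card_ord. Qed.

Lemma dart_biclique : dart_count biclique = 2 * (a * b).
Proof.
rewrite /dart_count /degree big_sumType /=.
under eq_bigr do rewrite big_sumType /= big1_eq sum1_card card_ord add0n.
under [X in _ + X]eq_bigr do rewrite big_sumType /= big1_eq sum1_card card_ord addn0.
by rewrite !sum_nat_const !card_ord; lia.
Qed.

(** The vertices embedded in the side of size [a] form a colour class of [H]. *)
Lemma biclique_contains (H : sgraph) : contains biclique H ->
  exists2 S : {set H}, #|S| <= a & forall x y : H, adj x y -> (x \in S) != (y \in S).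
Proof.
move=> [f fI fA].
exists [set x | if f x is inl _ then true else false]; last first.
  by move=> x y /fA; rewrite !inE; case: (f x); case: (f y).
set S := [set x | _].
rewrite -(card_imset S fI) -[leqRHS]card_ord -(card_imset 'I_a (@inl_inj 'I_a 'I_b)).
apply/subset_leq_card/subsetP => _ /imsetP[x + ->].
rewrite inE; case: (f x) => // i _; exact: imset_f.
Qed.

(** The successor map of the cycle injects the complement of the small class into that class. *)
Lemma biclique_cycle_free (m : nat) : contains biclique (cycle_graph m) -> 1 < m -> m <= 2 * a.
Proof.
move=> /biclique_contains[S Sa adjS] m1.
have CS : #|~: S| <= #|S|.
  rewrite -(card_imset (~: S) (@ordS_inj m)).
  apply/subset_leq_card/subsetP => _ /imsetP[i + ->].
  by rewrite inE; have := adjS _ _ (cycle_graph_adj_ordS i m1); case: (i \in S); case: (ordS i \in S).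
by have := cardsC S; rewrite card_ord; lia.
Qed.
End CompleteBipartite.

(** * Edge density without long cycles *)

Section Density.
Variable G : sgraph.

Definition induced_rel (S : {set G}) : rel {x : G | x \in S} :=
  fun u v => adj (val u) (val v).

Lemma induced_rel_sym S : symmetric (@induced_rel S).
Proof. by move=> x y; rewrite /induced_rel adj_sym. Qed.

Lemma induced_rel_irrefl S : irreflexive (@induced_rel S).
Proof. by move=> x; rewrite /induced_rel adj_irrefl. Qed.

Definition induced S := SGraph (@induced_rel_sym S) (@induced_rel_irrefl S).

Lemma contains_induced S : contains G (induced S).
Proof. by exists (val : induced S -> G); first exact: val_inj. Qed.

Lemma card_induced S : #|induced S| = #|S|.
Proof. by rewrite card_sig; apply: eq_card => x; rewrite inE. Qed.

Definition degree_in (S : {set G}) (x : G) := \sum_(y in S) (adj x y : nat).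

Definition darts_in (S : {set G}) := \sum_(x in S) degree_in S x.

Lemma degree_induced S (x : induced S) : degree x = degree_in S (val x).
Proof. by rewrite /degree_in (big_sub (mem S)). Qed.

Lemma dart_induced S : dart_count (induced S) = darts_in S.
Proof.
by rewrite /darts_in (big_sub (mem S)); apply: eq_bigr => x _; apply: degree_induced.
Qed.

Lemma darts_in_D1 (S : {set G}) (v : G) : v \in S ->
  darts_in S = darts_in (S :\ v) + 2 * degree_in S v.
Proof.
move=> vS.
have degD1 x : degree_in S x = adj x v + degree_in (S :\ v) x.
  by rewrite /degree_in (big_setD1 v).
rewrite /darts_in (big_setD1 v) //=.
under [X in _ + X]eq_bigr do rewrite degD1.
rewrite big_split /=.
have -> : \sum_(x in S :\ v) (adj x v : nat) = degree_in S v.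
  by rewrite degD1 adj_irrefl; apply: eq_bigr => x _; rewrite adj_sym.
by rewrite mul2n -addnn addnA addnC.
Qed.

(** Vertices other than [v] keep all their neighbours within their own piece, and the degree of [v]
    is shared between the two. *)
Lemma darts_in_split (S : {set G}) (v : G) (X : {set G}) : v \in S -> X \subset S :\ v ->
  (forall x y, x \in X -> y \in S -> y \notin X -> y != v -> ~~ adj x y) ->
  darts_in S <= darts_in (v |: X) + darts_in (S :\: X).
Proof.
move=> vS XS noadj; have /subsetD1P[XsubS vX] := XS.
have degS (A : {set G}) x : (forall y, y \in S -> adj x y -> y \in A) ->
    degree_in S x <= degree_in A x.
  move=> H; rewrite /degree_in big_mkcond [leqRHS]big_mkcond; apply: leq_sum => y _.
  by have := H y; case: (y \in S) => //; case: (adj x y) => [->//|_]; case: ifP.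
rewrite {1}/darts_in (big_setID X) /= (setIidPr XsubS) [darts_in (v |: X)]/darts_in.
rewrite big_setU1 //= [leqRHS]addnAC addnC leq_add //; last first.
  apply: leq_sum => x xX; apply: degS => y yS; apply: contraTT.
  by rewrite !inE negb_or => /andP[yv yX]; apply: noadj.
have vSX : v \in S :\: X by rewrite inE vX.
rewrite /darts_in !(big_setD1 v vSX) /= addnA leq_add //; last first.
  apply: leq_sum => x; rewrite !inE => /and3P[xv xX xS]; apply: degS => y yS.
  rewrite inE yS andbT adj_sym; apply: contraTN => yX; exact: noadj.
by rewrite /degree_in (big_setID X) /= (setIidPr XsubS) big_setU1 //= adj_irrefl.
Qed.

Lemma degree_in_le (S : {set G}) (x : G) : x \in S -> degree_in S x <= #|S|.-1.
Proof.
move=> xS; rewrite /degree_in (big_setD1 x) //= adj_irrefl add0n.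
apply: (@leq_trans (\sum_(y in S :\ x) 1)); first by apply: leq_sum => y _; apply: leq_b1.
by rewrite sum1_card (cardsD1 x S) xS.
Qed.

Lemma darts_in_trivial (S : {set G}) : darts_in S <= #|S| * #|S|.-1.
Proof. by rewrite -sum_nat_const; apply: leq_sum => x; apply: degree_in_le. Qed.

End Density.

Lemma contains_cycle (G : sgraph) (x : G) (p : seq G) :
  uniq (x :: p) -> cycle (@adj G) (x :: p) -> contains G (cycle_graph (size p).+1).
Proof.
move=> up cp; pose f (i : cycle_graph (size p).+1) := nth x (x :: p) i.
have step i : adj (f i) (f (ordS i)).
  rewrite /f /=; have im := ltn_ord i.
  have := pathP x cp i; rewrite size_rcons => /(_ im).
  rewrite -rcons_cons nth_rcons /= im nth_rcons.
  move: im; rewrite ltnS leq_eqVlt => /orP[/eqP->|ip].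
    by rewrite ltnn eqxx modnn.
  by rewrite ip modn_small.
exists f; first by move=> i j /eqP; rewrite nth_uniq // => /eqP/val_inj.
move=> i j /andP[_ /orP[]/eqP->]; first exact: step.
by rewrite adj_sym; apply: step.
Qed.

(** With M the maximum of t and E/(2t), this is e(S) <= M(|S| - 1) multiplied by 4t. The form |S| -
    1 is what adds up over two pieces sharing one vertex. *)
Lemma darts_in_le (G : sgraph) (t E : nat) :
  (forall m, 2 * t + 2 <= m -> ~ contains G (cycle_graph m)) ->
  (forall S : {set G}, #|S| = (2 * t).+1 -> darts_in S <= 2 * E) ->
  forall S : {set G}, S != set0 ->
    2 * t * darts_in S <= maxn ((2 * t) ^ 2) (2 * E) * #|S|.-1.
Proof.
move=> nocycle critical S; set N := maxn _ _.
have N1 : 2 * t * (2 * t) <= N by rewrite mulnn leq_maxl.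
have N2 : 2 * E <= N by rewrite leq_maxr.
have [n] := ubnP #|S|; elim: n S => // n IHn S; rewrite ltnS => Sn S0.
have S1 : 0 < #|S| by rewrite card_gt0.
(* At most 2t vertices: |S|(|S| - 1) darts are already few enough, as N >= (2t)^2. *)
have [small|] := leqP #|S| (2 * t).
  apply: (@leq_trans (2 * t * (2 * t * #|S|.-1))).
    rewrite leq_mul2l; apply/orP; right.
    by apply: leq_trans (darts_in_trivial S) _; rewrite leq_mul2r small orbT.
  by rewrite mulnA leq_mul2r N1 orbT.
rewrite leq_eqVlt => /orP[/eqP tS|tS].
  rewrite -tS /= mulnC leq_mul2r; apply/orP; right.
  by apply: leq_trans (critical S (esym tS)) N2.
(* Deleting a vertex of degree at most t costs at most 2t darts, paid for by the loss of one
   vertex. *)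
have [/existsP[v /andP[vS dv]]|/existsPn mindeg] :=
    boolP [exists v, (v \in S) && (degree_in S v <= t)].
  have cS : #|S| = #|S :\ v|.+1 by rewrite (cardsD1 v S) vS.
  have S'0 : S :\ v != set0 by rewrite -card_gt0; lia.
  have := IHn (S :\ v) _ S'0; rewrite -cS => /(_ Sn).
  rewrite (darts_in_D1 vS) mulnDr => IH.
  apply: (@leq_trans (N * #|S :\ v|.-1 + N)).
    apply: leq_add => //; apply: leq_trans N1; rewrite leq_mul2l; apply/orP; right.
    by rewrite leq_mul2l dv.
  by rewrite -mulnSr cS /= prednK //; lia.
have [sep|nonsep] := pselect (exists v (X : {set G}),
    [/\ v \in S, X \subset S :\ v, X != set0, X != S :\ v &
     forall x y, x \in X -> y \in S -> y \notin X -> y != v -> ~~ adj x y]).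
  have [v [X [vS XS X0 XnS noadj]]] := sep.
  have /subsetD1P[XsubS vX] := XS.
  have ltX : #|X| < #|S :\ v| by apply: proper_card; rewrite properEneq XnS.
  have cS : #|S| = #|S :\ v|.+1 by rewrite (cardsD1 v S) vS.
  have cvX : #|v |: X| = #|X|.+1 by rewrite cardsU1 vX.
  have cSX : #|S :\: X| = #|S| - #|X| by rewrite cardsD (setIidPr XsubS).
  have X1 : 0 < #|X| by rewrite card_gt0.
  apply: leq_trans (leq_mul (leqnn _) (darts_in_split vS XS noadj)) _.
  rewrite mulnDr (_ : #|S|.-1 = #|v |: X|.-1 + #|S :\: X|.-1); last by lia.
  rewrite mulnDr; apply: leq_add; apply: IHn; rewrite -?card_gt0; lia.
(* Now there are at least 2t + 2 vertices, no cut vertex, and all degrees are at least t + 1, so a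
   forbidden cycle appears. *)
exfalso.
have [||||[|x p] [up cp lp]] := @circumference_ge (induced S) t.+1.
- move=> v X vX /set0Pn[x xX] [y yX yv]; apply: contrapT => noedge; apply: nonsep.
  exists (val v), (val @: X); split.
  - exact: valP.
  - apply/subsetP => _ /imsetP[u uX ->]; rewrite !inE (valP u) andbT.
    by rewrite (inj_eq val_inj); apply: contraNneq vX => <-.
  - by apply/set0Pn; exists (val x); apply: imset_f.
  - apply: contraNneq yX => XE; have : val y \in val @: X.
      by rewrite XE !inE (valP y) andbT (inj_eq val_inj).
    by rewrite mem_imset //; apply: val_inj.
  - move=> _ w /imsetP[u uX ->] wS wX wv; apply/negP => auw; apply: noedge.
    exists u, (exist _ w wS); split=> //.
    by apply: contra wX => wX; apply/imsetP; exists (exist _ w wS).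
- by [].
- by rewrite card_induced; lia.
- move=> x; rewrite degree_induced ltnNge; apply/negP => dx.
  by have := mindeg (val x); rewrite (valP x) dx.
- by [].
apply: (nocycle (size p).+1); first by move: lp => /=; lia.
exact: contains_trans (contains_induced S) (contains_cycle up cp).
Qed.

Lemma dart_count_setT (G : sgraph) : dart_count G = darts_in [set: G].
Proof.
rewrite /darts_in big_mkcond; apply: eq_bigr => x _; rewrite inE.
by rewrite /degree_in [RHS]big_mkcond; apply: eq_bigr => y _; rewrite inE.
Qed.

(** * Bounds for the forbidden family *)

(** [S] is the class of colour [true] in a proper 2-colouring, hence one of the terms of the
    minimum. *)
Lemma color_class_gt (F : sgraph) (t : nat) (S : {set F}) :
  ((t + 1)%:R%:E <= min_color_class F)%E ->
  (forall x y : F, adj x y -> (x \in S) != (y \in S)) -> t < #|S|.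
Proof.
move=> tF adjS; pose c : {ffun F -> bool} := [ffun x => x \in S].
have pc : proper_2coloring c.
  by apply/forallP => x; apply/forallP => y; apply/implyP => /adjS; rewrite !ffunE.
have := le_trans tF (@bigmin_le_cond _ _ _ _ (c, true)
  (fun cb => proper_2coloring cb.1)
  (fun cb : {ffun F -> bool} * bool => (#|[set x | cb.1 x == cb.2]|%:R)%:E : \bar rat) pc).
rewrite lee_fin ler_nat addn1.
by rewrite (_ : [set x | _] = S) //; apply/setP => x; rewrite inE /= ffunE eqb_id.
Qed.

Section Bounds.
Variables (t : nat) (F : sgraph).
Hypothesis t_gt0 : 0 < t.
Hypothesis F2c : two_connected F.

Let FF : graph_family := fun H => cycles_ge (2 * t).+2 H \/ H = F.

Lemma block_family_forbidden : block_family FF.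
Proof.
move=> H [[m [m3 _ ->]]|->]; last first.
  split; last exact: two_connected_nonseparable.
  by case/and3P: F2c => /ltnW.
by rewrite card_ord; split; [apply: ltnW | apply: cycle_graph_nonseparable].
Qed.

Lemma block_family_single : block_family (fun H => H = F).
Proof. by move=> H ->; apply: block_family_forbidden; right. Qed.

(** A crude bound free of [F], so that the final error depends on k alone. *)
Lemma ex_number1_le : ex_number1 (2 * t).+1 F <= (2 * t).+1 ^ 2.
Proof.
have [G [cG _ dG]] := ex_number_attained (2 * t).+1 block_family_single.
have := darts_in_trivial [set: G]; rewrite -dart_count_setT dG cardsT cG /=.
by rewrite /ex_number1; nia.
Qed.

Lemma ex_number_upper (n : nat) : 0 < n ->
  2 * t * (2 * ex_number n FF)
    <= maxn ((2 * t) ^ 2) (2 * ex_number1 (2 * t).+1 F) * n.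
Proof.
move=> n0; have [G [cG fG dG]] := ex_number_attained n block_family_forbidden.
rewrite -dG dart_count_setT.
apply: leq_trans (@darts_in_le G t (ex_number1 (2 * t).+1 F) _ _ [set: G] _) _.
- move=> m tm; apply: fG; left; exists m; split=> //; lia.
- move=> S cS; rewrite -dart_induced -cS -card_induced; apply: ex_number_ge.
  move=> H ->; apply: is_free_contained (contains_induced S) fG F _; by right.
- by rewrite -card_gt0 cardsT cG.
by rewrite cardsT cG leq_mul2l leq_pred orbT.
Qed.

Lemma ex_number_lower_biclique (n : nat) :
  ((t + 1)%:R%:E <= min_color_class F)%E ->
  t <= n -> t * n <= ex_number n FF + t * t.
Proof.
move=> pF tn.
have := @ex_number_ge FF (biclique t (n - t)).
rewrite card_biclique dart_biclique subnKC // leq_mul2l /= mulnBr => H.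
have -> : t * n = t * n - t * t + t * t by rewrite subnK // leq_mul2l tn orbT.
rewrite leq_add2r; apply: H => K [[m [m3 km ->]]|->].
  by move/biclique_cycle_free; lia.
by move/biclique_contains=> [S St /(color_class_gt pF)]; rewrite ltnNge St.
Qed.

Lemma ex_number_lower_copies (n : nat) : 0 < n ->
  ex_number1 (2 * t).+1 F * n <= 2 * t * ex_number n FF + ex_number1 (2 * t).+1 F * (2 * t).
Proof.
case: n => // n _.
have E_le : ex_number1 (2 * t).+1 F <= ex_number (2 * t).+1 FF.
  have [G [cG fG dG]] := ex_number_attained (2 * t).+1 block_family_single.
  (* An extremal [F]-free graph on 2t + 1 vertices is too small to contain a cycle of length 2t + 2
     or more. *)
  have := @ex_number_ge FF G; rewrite cG dG leq_mul2l /=; apply=> H [[m [m3 km ->]]|->].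
    by move=> [f fI _]; have := leq_card f fI; rewrite cG card_ord; lia.
  exact: fG.
have := ex_number_copies (2 * t) (n %/ (2 * t)) (n %% (2 * t)) block_family_forbidden.
(* Besides the shared vertex, q copies use 2t vertices each and r < 2t are left over; these and the
   shared vertex account for the error term. *)
rewrite -divn_eq; have := divn_eq n (2 * t); have := ltn_pmod n (_ : 0 < 2 * t).
move: (n %/ _) (n %% _) (ex_number n.+1 FF) E_le => q r X E_le /(_ ltac:(lia)) rt en qX.
have : q * ex_number1 (2 * t).+1 F <= X by apply: leq_trans qX; rewrite leq_mul2l E_le orbT.
move: (ex_number1 _ _) => E qE; rewrite en.
apply: (@leq_trans (2 * t * (q * E) + E * (2 * t))); last by rewrite leq_add2r leq_mul2l qE orbT.
rewrite -addnS mulnDr; apply: leq_add; last by rewrite leq_mul2l rt orbT.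
by rewrite mulnCA mulnA mulnC mulnA.
Qed.

End Bounds.

(** * The asymptotic formula over the rationals *)

Local Open Scope ring_scope.

Theorem theorem6 (k : nat) (k_ge4 : (4 <= k)%N) (k_even : ~~ odd k) :
  let t := ((k - 1) %/ 2)%N in
  exists C : rat, forall F : sgraph,
    two_connected F -> ((t + 1)%:R%:E <= min_color_class F)%E ->
    exists n0 : nat, forall n : nat, (n0 <= n)%N ->
      `| (ex_number n (fun H => cycles_ge k H \/ H = F))%:R
       - n%:R * Num.max ((k%:R - 2) / 2)
                          ((ex_number1 (k - 1) F)%:R / (k%:R - 2)) |
      <= C.
Proof.
move=> t.
have kt : k = (2 * t).+2 by rewrite /t; lia.
have t0 : (0 < t)%N by lia.
move: t kt t0 => t kt t0; subst k => {k_ge4 k_even}.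
(* The constant dominates both lower-bound errors, [t * t] and the extremal number on k - 1
   vertices, and is chosen before [F]. *)
exists ((2 * t).+1 ^ 2)%:R => F F2c pF; exists t.+1 => n tn.
have n0 : (0 < n)%N by lia.
have := ex_number_lower_copies t0 F2c n0.
have := ex_number_lower_biclique t0 F2c pF (ltnW tn).
have := ex_number_upper t0 F2c n0.
have := ex_number1_le t0 F2c.
rewrite (_ : (2 * t).+2 - 1 = (2 * t).+1)%N; last by lia.
move: (ex_number1 _ _) (ex_number n _) => E X EC upper lower1 lower2.
have tt : (t * t <= (2 * t).+1 ^ 2)%N by nia.
move: ((2 * t).+1 ^ 2)%N EC tt => C EC tt.
have -> : ((2 * t).+2%:R - 2 = 2 * t%:R :> rat) by rewrite -addn2 natrD natrM; ring.
have T0 : 0 < t%:R :> rat by rewrite ltr0n.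
move: EC tt lower1 lower2; rewrite -!(ler_nat rat) !natrD !natrM.
move=> EC tt lower1 lower2.
(* Division by 4t, separately for each value of the natural-number maximum. *)
have upper' : (X%:R <= n%:R * t%:R :> rat) \/ (X%:R <= n%:R * (E%:R / (2 * t%:R)) :> rat).
  move: upper; rewrite -mulnn /maxn; case: ifP => _; rewrite -(ler_nat rat) !natrM.
    move=> u; right; rewrite mulrA ler_pdivlMr; nra.
  move=> u; left; rewrite -(ler_pM2l (_ : 0 < 2 * t%:R * 2)); nra.
have lower2' : n%:R * (E%:R / (2 * t%:R)) <= X%:R + E%:R :> rat.
  by rewrite mulrA ler_pdivrMr; nra.
rewrite (_ : 2 * t%:R / 2 = t%:R); last by field.
have n0' : 0 <= n%:R :> rat by rewrite ler0n.
rewrite maxr_pMr //.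
move: upper' lower1 lower2' EC tt; rewrite [t%:R * n%:R]mulrC.
move: (n%:R * t%:R) (n%:R * (_ / _)) => a b upper' lower1 lower2' EC tt.
(* The upper bound has no error; from below, the construction matching the larger of [a] and [b] is
   used. *)
by rewrite ler_norml; case: (@lerP rat a b) => ab; case: upper' => ?; apply/andP; split; lra.
Qed.
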